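(* There is a universal constant $c_A$ with $0<c_A\le 3/\log_2 5$ such that every finite solvable group $G$ with a Carter subgroup $C$ is a product (setwise) of at most $1+c_A\log_2|G:C|$ conjugates of $C$.
   Context: A Carter subgroup of a finite group $G$ is a nilpotent subgroup $C\le G$ with $N_G(C)=C$. *)

(* Defs.v *)
From mathcomp Require Import all_boot all_fingroup all_solvable.
From Stdlib Require Import Reals.
Set Implicit Arguments. Unset Strict Implicit. Unset Printing Implicit Defensive.

Definition carter_subgroup (gT : finGroupType) (C G : {set gT}) : bool :=
  [&& C \subset G, nilpotent C & ('N_G(C))%g == C].

Definition conj_prod (gT : finGroupType) (C : {set gT}) (gs : seq gT) : {set gT} :=
  (\prod_(g <- gs) (C :^ g))%g.

Definition log2R (x : R) : R := (ln x / ln 2)%R.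

(* Main.v *)
Require Import Defs.
From mathcomp Require Import all_boot all_fingroup all_solvable.
Set Implicit Arguments. Unset Strict Implicit. Unset Printing Implicit Defensive.
Import GroupScope.

(* Induct on |G| with a minimal normal subgroup N.  If NC < G, factorizations of
   G/N and of NC glue together, because the last conjugate of CN in a factorization
   of G can be taken to be NC itself.  If G = NC and C < G, then N is an irreducible
   nontrivial C-module, and an element z of the nilpotent group C that is central
   modulo C_C(N) has no fixed points on N.  So every pair {1, b} in N is a translate
   of some {a, a^z}, and a product of t pairs is covered by t + 1 conjugates of C.
   Finally N is a product of t pairs with 5^t <= |N|^3: a cyclic group of order n
   is the product of the {1, x^(2^i)} for i < ceil(log_2 n). *)

(** * Products of pairs covering an abelian group *)

(** Writing the logarithm as t + 1 gives 2^t < n. For t > 3 the bound follows from 5^(t+1) <= 8^t,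
    which starts at 5^5 <= 8^4; for t <= 3 it follows from 5^(t+1) <= (2^t + 1)^3. Equality at n = 5
    is what dictates the constant 3 / log_2 5. *)
Lemma leq_exp5_up_log n : (0 < n)%N -> (5 ^ up_log 2 n <= n ^ 3)%N.
Proof.
case: n => [//|[|n]] _; first by rewrite up_log1.
have := @up_log_gtn 2 n.+2 isT isT; have := up_log_gt0 2 n.+2.
case: (up_log 2 n.+2) => [//|t] _ /=; move: n.+2 => m lt_tm.
have [lt4t | let3] := ltnP 3 t; last first.
  have le_tm : ((2 ^ t).+1 ^ 3 <= m ^ 3)%N by rewrite leq_exp2r.
  by apply: leq_trans le_tm; move: let3; do 4?[case: t lt_tm => [|t] lt_tm //].
apply: (@leq_trans ((2 ^ t) ^ 3)%N); last by rewrite leq_exp2r // ltnW.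
rewrite -expnM mulnC expnM -[(2 ^ 3)%N]/8.
elim: t lt4t {lt_tm} => // t IHt; rewrite ltnS leq_eqVlt => /predU1P[<- //|/IHt le_t].
by rewrite expnS [leqRHS]expnS leq_mul.
Qed.

(** The binary digits of [m] say which entry to take from each pair; the induction strips the top
    digit. *)
Lemma mem_prod_pairs (gT : finGroupType) (x : gT) t m :
  (m < 2 ^ t)%N -> x ^+ m \in \prod_(b <- [seq x ^+ (2 ^ i) | i <- iota 0 t]) [set 1; b].
Proof.
elim: t m => [|t IHt] m lt_m.
  by rewrite big_nil; move: lt_m; case: m => // _; rewrite expg0 inE.
rewrite -[t.+1]addn1 iotaD map_cat big_cat /= big_seq1 add0n.
have [lt_mt | le_tm] := ltnP m (2 ^ t)%N.
  by rewrite -[_ ^+ m]mulg1 mem_mulg ?IHt // !inE eqxx.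
rewrite -(subnK le_tm) expgD mem_mulg ?IHt ?inE ?eqxx ?orbT //.
by rewrite ltn_subLR // addnn -mul2n -expnS.
Qed.

Lemma prod_pairs_sub (gT : finGroupType) (H : {group gT}) (bs : seq gT) :
  {subset bs <= H} -> \prod_(b <- bs) [set 1; b] \subset H.
Proof.
elim: bs => [|b bs IHb] sbsH; first by rewrite big_nil sub1G.
rewrite big_cons mul_subG ?IHb // => [|x bsx]; last by rewrite sbsH ?inE ?bsx ?orbT.
by apply/subsetP=> x; rewrite !inE => /pred2P[]->; rewrite ?group1 ?sbsH ?inE ?eqxx.
Qed.

Lemma abelian_prod_pairs (gT : finGroupType) (A : {group gT}) :
  abelian A -> exists bs : seq gT,
    [/\ {subset bs <= A}, (5 ^ size bs <= #|A| ^ 3)%N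
      & \prod_(b <- bs) [set 1; b] = A].
Proof.
case/abelian_structure=> xs defA _.
have [bs [szbs eq_bs]] : exists bs : seq gT,
    (5 ^ size bs <= (\prod_(x <- xs) #[x]%N) ^ 3)%N
    /\ \prod_(b <- bs) [set 1; b] = \prod_(x <- xs) <[x]>.
- elim: xs {defA} => [|x xs [bs [szbs eq_bs]]].
    by exists nil; rewrite !big_nil.
  exists ([seq x ^+ (2 ^ i) | i <- iota 0 (up_log 2 #[x])] ++ bs); split.
    rewrite big_cons size_cat size_map size_iota expnD expnMn.
    by rewrite leq_mul ?leq_exp5_up_log ?order_gt0.
  rewrite big_cat /= eq_bs [RHS]big_cons; congr (_ * _).
  apply/eqP; rewrite eqEsubset prod_pairs_sub => [|y /mapP[i _ ->]]; last first.
    exact: mem_cycle.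
  apply/subsetP=> _ /cyclePmin[m lt_m ->]; apply: mem_prod_pairs.
  by apply: leq_trans lt_m _; apply: up_logP.
have eqA : \prod_(b <- bs) [set 1; b] = A by rewrite eq_bs (bigdprodW defA).
exists bs; split=> //; last by rewrite -(bigdprod_card defA).
(* Each [b] in [bs] lies in the product: take [b] from its own pair and 1 from all the others. *)
rewrite -eqA; elim: bs {szbs eq_bs eqA} => // b bs IHb x.
have prod1 (s : seq gT) : 1 \in \prod_(b <- s) [set 1; b].
  elim: s => [|c s IHs]; first by rewrite big_nil inE.
  by rewrite big_cons; apply/mulsgP; exists 1 1; rewrite ?mulg1 ?set21.
rewrite inE big_cons => /predU1P[-> | /IHb bsx].
  by apply/mulsgP; exists b 1; rewrite ?mulg1 ?set22.
by apply/mulsgP; exists 1 x; rewrite ?mul1g ?set21.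
Qed.

(** * Products of conjugates when an element acts without fixed points *)

Lemma conj_prodJ (gT : finGroupType) (C : {set gT}) gs x :
  conj_prod C [seq g * x | g <- gs] = conj_prod C gs :^ x.
Proof.
rewrite /conj_prod; elim: gs => [|g gs IHg] /=; first by rewrite !big_nil conjs1g.
by rewrite !big_cons conjsMg -IHg conjsgM.
Qed.

(** If [[~ a1, z] = [~ a2, z]], then [z] centralises [a2 * a1^-1], which is therefore 1. So [a] |->
    [[~ a, z]] is injective on the finite set [N], hence onto. *)
Lemma commg_regular_onto (gT : finGroupType) (N : {group gT}) (z b : gT) :
  z \in 'N(N) -> 'C_N[z] = 1 -> b \in N -> exists2 a, a \in N & b = [~ a, z].
Proof.
move=> nNz regz Nb; pose f a := [~ a, z].
have Nf : f @: N \subset N.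
  apply/subsetP=> _ /imsetP[a Na ->]; rewrite /f commgEl groupM ?groupV //.
  by rewrite memJ_norm.
have injf : {in N &, injective f}.
  move=> a1 a2 Na1 Na2; rewrite /f !commgEl => eq12.
  have: a2 * a1^-1 \in 'C_N[z].
    rewrite inE groupM ?groupV //=; apply/cent1P/commgP/conjg_fixP.
    rewrite conjMg conjVg; apply: (mulgI a2^-1); rewrite mulgA -eq12.
    by rewrite mulgK mulKg.
  by rewrite regz => /set1P/(canRL (mulgKV _)); rewrite mul1g.
have /eqP eqf : f @: N == N by rewrite eqEcard Nf /= (card_in_imset injf) leqnn.
by move: Nb; rewrite -{1}eqf => /imsetP[a Na ->]; exists a.
Qed.

(* Since [z] acts without fixed points, every [{1, b}] is a translate of a set
   [{a, a ^ z}], so each further factor [C] contributes one pair. *)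
Lemma conj_prod_pairs (gT : finGroupType) (N C : {group gT}) (z : gT) bs :
  abelian N -> C \subset 'N(N) -> z \in C -> 'C_N[z] = 1 -> {subset bs <= N} ->
  exists gs y u, [/\ {subset gs <= N}, size gs = (size bs).+1, y \in N /\ u \in N,
    C * conj_prod C gs = conj_prod C gs
    & u *: \prod_(b <- bs) [set 1; b] * C \subset conj_prod C gs :* y].
Proof.
move=> abN nNC Cz regz; elim: bs => [_|b bs IHb sbN].
  exists [:: 1], 1, 1; rewrite /conj_prod !big_cons !big_nil conjsg1 !mulg1.
  by split; rewrite ?mulGid ?lcoset1 // => x; rewrite inE => /eqP->.
have Nb : b \in N by rewrite sbN ?inE ?eqxx.
have{IHb} [x bsx|gs [y [u [sgN szgs [Ny Nu] CP sXP]]]] := IHb.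
  by rewrite sbN // inE bsx orbT.
have [a Na def_b] := commg_regular_onto (subsetP nNC z Cz) regz Nb.
exists (1 :: [seq g * a^-1 | g <- gs]), (a * y), (a * u).
have defP : conj_prod C (1 :: [seq g * a^-1 | g <- gs]) = C * conj_prod C gs :^ a^-1.
  by rewrite {1}/conj_prod big_cons conjsg1 -conj_prodJ.
split; rewrite ?groupM ?defP ?mulgA ?mulGid //=.
- by move=> g /predU1P[->|/mapP[h /sgN Nh ->]]; rewrite ?group1 ?groupM ?groupV.
- by rewrite size_map szgs.
apply/subsetP=> _ /mulsgP[_ c0 /lcosetP[_ /[!big_cons] /mulsgP[e x Ee Xx ->] ->] Cc0 ->].
(* This is the equality of a{1, b} with {a, a^z}: [c] is 1 for the first entry and [z^-1] for the
   second. *)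
have [c Cc def_e] : exists2 c, c \in C & c * a * c^-1 = a * e.
  move: Ee; rewrite !inE => /pred2P[]->; first by exists 1; rewrite ?mulg1 ?invg1 ?mul1g ?mulg1.
  by exists z^-1; rewrite ?groupV // invgK def_b commgEl mulKVg conjgE mulgA.
have Ne : e \in N by move: Ee; rewrite !inE => /pred2P[]->.
have : u * x * c0 \in conj_prod C gs :* y.
  by apply: (subsetP sXP); rewrite mem_mulg // mem_lcoset mulKg.
case/rcosetP=> q Pq def_q.
(* Left invariance under [C], carried through the induction for this purpose, absorbs [c^-1]. *)
have Pcq : c^-1 * q \in conj_prod C gs by rewrite -CP mem_mulg ?groupV.
apply/rcosetP; exists (c * (c^-1 * q) ^ a^-1); first by rewrite mem_mulg // memJ_conjg.
have -> : a * u * (e * x) * c0 = a * e * (u * x * c0).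
  by rewrite !mulgA -(mulgA a u e) (centsP abN u Nu e Ne) !mulgA.
by rewrite -def_e def_q conjgE invgK !mulgA mulgKV.
Qed.

Lemma conj_prod_sub (gT : finGroupType) (C G : {group gT}) gs :
  C \subset G -> {subset gs <= G} -> conj_prod C gs \subset G.
Proof.
move=> sCG; rewrite /conj_prod; elim: gs => [|g gs IHg] sgG.
  by rewrite big_nil sub1G.
rewrite big_cons mul_subG ?IHg // => [|x gsx]; last by rewrite sgG ?inE ?gsx ?orbT.
by rewrite -(conjGid (sgG g _)) ?conjSg ?inE ?eqxx.
Qed.

(** The length bound 1 + 3 log_5 |G:C|, exponentiated so that it stays in the naturals and bounds
    multiply along a chain of subgroups. *)
Definition short_conj_factorization (gT : finGroupType) (G C : {group gT}) :=
  exists gs : seq gT, [/\ {subset gs <= G}, (5 ^ size gs <= 5 * #|G : C| ^ 3)%N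
                        & conj_prod C gs = G].

(** When the pairs multiply to all of [N], the translation by [u] disappears, and the one by [y] is
    undone inside NC. The extra conjugate costs the factor 5, and |NC : C| = |N|. *)
Lemma regular_short_factorization (gT : finGroupType) (N C : {group gT}) z :
  abelian N -> C \subset 'N(N) -> z \in C -> 'C_N[z] = 1 -> N :&: C = 1 ->
  short_conj_factorization (N <*> C) C.
Proof.
move=> abN nNC Cz regz tiNC.
have [bs [sbN szbs defN]] := abelian_prod_pairs abN.
have [gs [y [u [sgN szgs [Ny Nu] _]]]] := conj_prod_pairs abN nNC Cz regz sbN.
rewrite defN lcoset_id // -norm_joinEr // => sGP.
have sgG : {subset gs <= N <*> C} by move=> g /sgN; apply/subsetP/joing_subl.
exists gs; split=> //.
  rewrite szgs expnS leq_mul2l /= (leq_trans szbs) // leq_exp2r //.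
  rewrite -divgS ?joing_subr // /= norm_joinEr // TI_cardMg // mulnK ?cardG_gt0 //.
apply/eqP; rewrite eqEsubset conj_prod_sub ?joing_subr //=.
have := mulSg [set y^-1] sGP.
by rewrite -!mulgA mulg_set1 mulgV mulg1 rcoset_id // groupV (subsetP (joing_subl N C)).
Qed.

(** * Carter subgroups modulo a normal p-subgroup *)

(** The p-group MQ centralises H, so whatever in it normalises Q also normalises C = QH; it then
    lies in C, hence in Q. Normalisers grow in p-groups, so MQ = Q. *)
Lemma carter_centraliser_sub (gT : finGroupType) (p : nat) (N C G : {group gT}) :
  carter_subgroup C G -> p.-group N -> N \subset G -> C \subset 'N(N) ->
  'C_N('O_p^'(C)) \subset C.
Proof.
case/and3P=> sCG nilC /eqP selfC pN sNG nNC.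
set H := 'O_p^'(C); set Q := 'O_p(C); set M := 'C_N(H).
have defC : Q \x H = C := nilpotent_pcoreC p nilC.
have [_ defQH cQH _] := dprodP defC.
have nMQ : Q \subset 'N(M).
  by rewrite normsI ?(subset_trans (pcore_sub _ _) nNC) // norms_cent // cents_norm // centsC.
have sQP : Q \subset M <*> Q := joing_subr _ _.
have pP : p.-group (M <*> Q).
  by rewrite norm_joinEr // pgroupM pcore_pgroup (pgroupS (subsetIl _ _)).
have sPG : M <*> Q \subset G.
  by rewrite join_subG subIset ?sNG // (subset_trans (pcore_sub _ _)).
have sNQ : 'N_(M <*> Q)(Q) \subset Q.
  have sNC : 'N_(M <*> Q)(Q) \subset C.
    rewrite -selfC subsetI subIset ?sPG //= -defQH normsM ?subsetIr //.
    rewrite cents_norm // (subset_trans (subsetIl _ _)) // join_subG subsetIr /=.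
    by rewrite centsC.
  rewrite (sub_normal_Hall (nilpotent_pcore_Hall p nilC)) ?pcore_normal //.
  exact: pgroupS (subsetIl _ _) pP.
have defP := nilpotent_sub_norm (pgroup_nil pP) sQP sNQ.
by rewrite (subset_trans (joing_subl M Q)) //= defP pcore_sub.
Qed.

(* The Hall p'-subgroup H of C is one of NC as well, and N_{NC}(H) = C. An element
   g normalising NC can therefore be adjusted by NC to normalise H, hence C. *)
Lemma carter_quotient (gT : finGroupType) (p : nat) (N C G : {group gT}) :
  solvable G -> carter_subgroup C G -> p.-group N -> N <| G ->
  carter_subgroup (C / N) (G / N).
Proof.
move=> solG carC pN /andP[sNG nNG]; have [sCG nilC /eqP selfC] := and3P carC.
have nNC := subset_trans sCG nNG.
rewrite /carter_subgroup quotientS ?quotient_nil //=.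
have sNC_G : N <*> C \subset G by rewrite join_subG sNG.
have nN_NC : N <| N <*> C by rewrite normalYl.
rewrite -(quotientYidl nNC) -quotient_subnormG //.
suffices -> : 'N_G(N <*> C) = N <*> C by [].
apply/eqP; rewrite eqEsubset subsetI sNC_G normG !andbT.
pose H := 'O_p^'(C)%G.
have hallH : p^'.-Hall(N <*> C) H.
  have hallHC : p^'.-Hall(C) H := nilpotent_pcore_Hall _ nilC.
  rewrite pHallE (subset_trans (pcore_sub _ _) (joing_subr _ _)) /=.
  rewrite (card_Hall hallHC) norm_joinEr // -LagrangeMr partnM ?cardG_gt0 //.
  by rewrite (@part_p'nat _ #|N : C|) ?mul1n ?pnatNK ?(pnat_dvd (dvdn_indexg _ _) pN).
have selfH : 'N_(N <*> C)(H) = C.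
  apply/eqP; rewrite eqEsubset subsetI joing_subr (char_norm (pcore_char _ _)) !andbT.
  (* By the modular law only N_N(H) needs to be placed in C. Its commutator with H lies in both N
     and H, which have coprime orders, so it centralises H. *)
  rewrite norm_joinEr // setIC -group_modr ?char_norm ?pcore_char // [_ :&: N]setIC mul_subG //.
  apply: subset_trans (carter_centraliser_sub carC pN sNG nNC).
  have sHC : H \subset C := pcore_sub _ _.
  rewrite subsetI subsetIl; apply/commG1P/trivgP.
  rewrite -(coprime_TIg (pnat_coprime pN (pcore_pgroup p^' C))) subsetI commg_subr subsetIr andbT.
  rewrite (subset_trans (commSg H (subsetIl N _))) // commg_subl.
  exact: subset_trans nNC.
apply/subsetP=> g /setIP[Gg nNCg].
have hallHg : p^'.-Hall(N <*> C) (H :^ g)%G by rewrite -{1}(normP nNCg) pHallJ2.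
have [x NCx /= defHg] := Hall_trans (solvableS sNC_G solG) hallHg hallH.
have nHgx : g * x^-1 \in 'N(H) by apply/normP; rewrite conjsgM defHg conjsgK.
suffices Cgx : g * x^-1 \in C.
  by rewrite -(mulgKV x g) groupM // (subsetP (joing_subr N C)).
rewrite -selfC; apply/setIP; split; first by rewrite groupM ?groupV ?(subsetP sNC_G x).
apply/normP; rewrite -selfH conjIg -normJ (normP nHgx) (normP _) //.
by rewrite groupM ?groupV // (subsetP (normG (N <*> C))).
Qed.

(** Take [z] outside C(N) in the first term of the upper central series of [C] that does not
    centralise [N]. Then [z, C] centralises [N], so ['C_N[z]] is normal in NC, and minimality makes
    it 1 or [N]. *)
Lemma nilpotent_minnormal_regular (gT : finGroupType) (N C : {group gT}) :
  nilpotent C -> abelian N -> minnormal N (N <*> C) -> ~~ (C \subset 'C(N)) ->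
  exists2 z, z \in C & 'C_N[z] = 1.
Proof.
move=> nilC abN minN ncCN.
have [/andP[_ nN_NC] minN'] := mingroupP minN.
have nNC := subset_trans (joing_subr N C) nN_NC.
have [n0 Zn0] := ucnP _ nilC.
pose P n := ~~ ('Z_n(C) \subset 'C(N)).
have exP : exists n, P n by exists n0; rewrite /P Zn0.
case: (ex_minnP exP) => [[|n]]; first by rewrite /P ucn0 sub1G.
case/subsetPn=> z; rewrite ucnSnR => /[!inE] /andP[Cz sRz] ncz minn.
have sZC : 'Z_n(C) \subset 'C(N) by apply: contraT => /minn; rewrite ltnn.
exists z => //; apply/eqP; apply: contraR ncz => ntC.
suffices <- : 'C_N[z] = N by rewrite -sub_cent1 subsetIr.
apply: (minN' [group of 'C_N[z]]); last exact: subsetIl.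
rewrite ntC /= join_subG (sub_abelian_norm abN) ?subsetIl //=.
(* Conjugating [z] by [C] changes it only by elements centralising [N]. *)
apply/normsP=> c Cc; apply/eqP.
rewrite eqEcard cardJg leqnn andbT; apply/subsetP=> _ /imsetP[x /setIP[Nx cxz] ->].
have Nxc : x ^ c \in N by rewrite memJ_norm // (subsetP nNC).
have cR : [~ z, c] \in 'C(N).
  by apply: (subsetP sZC); apply: (subsetP sRz); rewrite mem_commg ?set11.
rewrite inE Nxc /= cent1C.
have -> : z = z ^ c * [~ z, c]^-1 by rewrite commgEl invMg invgK mulKVg.
rewrite groupM ?groupV //; last by rewrite cent1C; apply/cent1P/commute_sym/(centP cR).
by rewrite /= cent1J memJ_conjg cent1C.
Qed.

(** * Gluing factorizations and the induction *)

Lemma short_factorization_quotient (gT : finGroupType) (N C G : {group gT}) :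
  N <| G -> C \subset G -> short_conj_factorization (G / N) (C / N) ->
  short_conj_factorization (N <*> C) C -> short_conj_factorization G C.
Proof.
move=> /andP[sNG nNG] sCG [hs [shG szhs defGN]] [gs [sgNC szgs defNC]].
have nNC := subset_trans sCG nNG.
have sNC_G : N <*> C \subset G by rewrite join_subG sNG.
have idx : (#|G / N : C / N| * #|N <*> C : C| = #|G : C|)%N.
  rewrite -(Lagrange_index sNC_G (joing_subr _ _)); congr (_ * _)%N.
  rewrite -(quotientYidl nNC) index_quotient_eq //.
  by rewrite (subset_trans (subsetIr _ _)) ?joing_subl.
have [ks [skG szks defks]] : exists ks, [/\ {subset ks <= G}, size ks = size hs
    & conj_prod C ks / N = conj_prod (C / N) hs].
- elim: hs shG {szhs defGN} => [|h hs IHh] shG.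
    by exists nil; rewrite /conj_prod !big_nil quotient1.
  have [x hsx|ks [skG szks defks]] := IHh; first by rewrite shG // inE hsx orbT.
  have /morphimP[k nNk Gk def_h] := shG h (mem_head _ _).
  exists (k :: ks); split=> /=; rewrite ?szks //.
    by move=> x /predU1P[->|/skG].
  rewrite /conj_prod !big_cons quotientMl; last first.
    by rewrite -(normP nNk) normJ conjSg.
  by rewrite -/(conj_prod C ks) defks def_h quotientJ.
have{defks} defG : N * conj_prod C ks = G.
  rewrite -quotientK ?(subset_trans (conj_prod_sub _ _) nNG) //.
  by rewrite defks defGN quotientGK // /normal sNG.
(* An empty lift means G = N, so the factorization of NC already serves. *)
case/lastP: ks skG szks defG => [|ks k] skG szks defG.
  exists gs; split=> [g /sgNC||].
  - exact: subsetP.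
  - by rewrite (leq_trans szgs) // leq_mul2l leq_exp2r // -idx leq_pmull.
  rewrite defNC; apply/eqP; rewrite eqEsubset sNC_G /=.
  by rewrite -{1}defG /conj_prod big_nil mulg1 joing_subl.
have Gk : k \in G by rewrite skG ?mem_rcons ?mem_head.
have{}skG x : x \in ks -> x \in G by move=> ksx; rewrite skG // mem_rcons inE ksx orbT.
(* Conjugating by [k^-1] turns the last factor into [C]; [N] then moves right past the others to
   form NC, which [gs] factorizes. *)
exists ([seq x * k^-1 | x <- ks] ++ gs); split.
- move=> x; rewrite mem_cat => /orP[/mapP[y ksy ->]|/sgNC].
    by rewrite groupM ?groupV ?(skG y).
  exact: subsetP.
(* The last conjugate of the lift is replaced by [gs], and this saving cancels one of the two
   factors 5. *)
- rewrite size_cat size_map -(leq_pmul2l (isT : 0 < 5)%N) -expnS -addSn.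
  rewrite -(size_rcons ks k) szks expnD (leq_trans (leq_mul szhs szgs)) //.
  by rewrite -idx expnMn [leqRHS]mulnA mulnACA.
have <- : G :^ k^-1 = G by rewrite conjGid ?groupV.
rewrite -{}defG; set A := conj_prod C (rcons ks k).
have -> : conj_prod C ([seq x * k^-1 | x <- ks] ++ gs) =
    conj_prod C [seq x * k^-1 | x <- ks] * (N <*> C) by rewrite -defNC /conj_prod big_cat.
have -> : A = conj_prod C ks * C :^ k.
  by rewrite /A /conj_prod -cats1 big_cat big_seq1.
have sKN : conj_prod C ks \subset 'N(N).
  exact: subset_trans (conj_prod_sub sCG skG) nNG.
rewrite mulgA -(normC sKN) !conjsMg conj_prodJ conjsgK norm_joinEr // -mulgA.
by rewrite [N :^ _](normP _) // groupV (subsetP nNG).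
Qed.

Theorem carter_short_factorization (gT : finGroupType) (G C : {group gT}) :
  solvable G -> carter_subgroup C G -> short_conj_factorization G C.
Proof.
have [n] := ubnP #|G|; elim: n gT G C => // n IHn gT G C /ltnSE leGn solG carC.
have [sCG nilC /eqP selfC] := and3P carC.
have [eqCG | neqCG] := eqVneq (C : {set gT}) G.
  exists [:: 1]; split; first by move=> x; rewrite inE => /eqP->.
    by rewrite leq_pmulr // expn_gt0 indexg_gt0.
  by rewrite /conj_prod big_seq1 conjsg1.
have ntG : G :!=: 1.
  by apply: contraNneq neqCG => G1; move: sCG; rewrite G1 => /trivgP->.
have [N minN sNG] := minnormal_exists ntG (normG G).
have [nNG ntN /is_abelemP[p pr_p abelN]] := minnormal_solvable minN sNG solG.
have nsNG : N <| G by apply/andP.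
have [ltNC | geNC] := boolP (N <*> C \proper G).
  apply: (short_factorization_quotient nsNG sCG).
    apply: IHn; rewrite ?quotient_sol ?(carter_quotient solG carC (abelem_pgroup abelN)) //.
    exact: leq_trans (ltn_quotient ntN sNG) leGn.
  have sNC_G := proper_sub ltNC.
  apply: IHn; rewrite ?(solvableS sNC_G) ?(leq_trans (proper_card ltNC)) //.
  rewrite /carter_subgroup joing_subr nilC eqEsubset subsetI joing_subr normG andbT /=.
  by rewrite (subset_trans (setSI _ sNC_G)) ?selfC.
have defG : N <*> C = G.
  by apply: contraNeq geNC; rewrite properEneq join_subG sNG sCG => ->.
have abN := abelem_abelian abelN; have nNC := subset_trans sCG nNG.
(* If [C] centralised [N], then [N] would lie in N_G(C) = C and G = NC would equal [C]. *)
have ncCN : ~~ (C \subset 'C(N)).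
  apply: contra neqCG => cCN; rewrite eqEsubset sCG -defG join_subG subxx andbT.
  by rewrite -selfC subsetI sNG cents_norm // centsC.
have [z Cz regz] : exists2 z, z \in C & 'C_N[z] = 1.
  by apply: nilpotent_minnormal_regular; rewrite ?defG.
have eqG : G = (N <*> C)%G by apply: val_inj; rewrite /= defG.
rewrite eqG; apply: regular_short_factorization regz _ => //.
have [_ minN'] := mingroupP minN.
(* The intersection is normalised by [C] and by the abelian [N]; if nontrivial, it is [N] by
   minimality, forcing G = C. *)
apply: contraNeq neqCG => ntNC.
have: [group of N :&: C] = N :> {set gT}.
  rewrite (minN' [group of N :&: C]) ?subsetIl // ntNC /= -defG join_subG.
  by rewrite (sub_abelian_norm abN) ?subsetIl // normsI ?normG.
by move/setIidPl=> sNC; rewrite eqEsubset sCG -defG join_subG sNC subxx.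
Qed.

(* Passage to real logarithms *)
From Stdlib Require Import Reals Lra.

Theorem theorem3 :
  exists cA : R, (0 < cA)%R /\ (cA <= 3 / log2R 5)%R /\
    forall (gT : finGroupType) (G C : {group gT}),
      solvable G -> carter_subgroup C G ->
      exists gs : seq gT,
        all (fun g => g \in G) gs /\
        (INR (size gs) <= 1 + cA * log2R (INR #|G : C|%g))%R /\
        conj_prod C gs = G.
Proof.
have ln2_gt0 : (0 < ln 2)%R by rewrite -ln_1; apply: ln_increasing; lra.
have ln5_gt0 : (0 < ln 5)%R by rewrite -ln_1; apply: ln_increasing; lra.
(* The upper limit itself works: taking logarithms in 5^s <= 5 |G:C|^3 gives s <= 1 + 3 log_5
   |G:C|. *)
exists (3 / log2R 5)%R; split; last split; first 1 last.
- exact: Rle_refl.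
- move=> gT G C solG carC.
  have [gs [sgG szgs defG]] := carter_short_factorization solG carC.
  exists gs; split; [exact/allP | split=> //].
  have INRX m k : INR (expn m k) = (INR m ^ k)%R.
    by elim: k => [|k IHk]; rewrite ?expn0 // expnS mult_INR IHk.
  have idx_gt0 : (0 < INR #|G : C|%g)%R by apply/lt_0_INR/ltP/indexg_gt0.
  have := le_INR _ _ (elimT leP szgs); rewrite mult_INR !INRX.
  have -> : INR 5 = 5%R by rewrite /=; lra.
  set s := size gs; set i := INR _ => le_s.
  have : (ln (5 ^ s) <= ln (5 * i ^ 3))%R.
    case: le_s => [lt_s | ->]; last exact: Rle_refl.
    by left; apply: ln_increasing lt_s; apply: pow_lt; lra.
  rewrite ln_mult ?ln_pow //; try lra; last exact: pow_lt.
  rewrite /log2R => le_ln.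
  have -> : (1 + 3 / (ln 5 / ln 2) * (ln i / ln 2) = (ln 5 + 3 * ln i) / ln 5)%R.
    by field; lra.
  apply: (Rmult_le_reg_r (ln 5)) => //.
  rewrite /Rdiv Rmult_assoc Rinv_l; last lra.
  move: le_ln => /=; lra.
- apply: Rdiv_lt_0_compat; first lra; exact: Rdiv_lt_0_compat.
Qed.
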